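(* Let $(X,m)$ be a relative Frobenius algebra, with unit $u$ identified with a subset $U\subseteq X$. Put $G_1=X$, $G_0=U$, $G_2=\{(g,f)\in X^2\mid gf\downarrow\}$, and define relations $$e=\{(u,u)\mid u\in U\}\subseteq G_0\times G_1,\qquad s=\{(f,x)\in G_1\times G_0\mid fx\downarrow\},\qquad t=\{(f,y)\in G_1\times G_0\mid yf\downarrow\},$$ $$i=\{(g,f)\in G_2\mid gf\in G_0,\ fg\in G_0\}\subseteq G_1\times G_1 .$$ Then these data, with composition given by $m$, form a groupoid in $\mathbf{Set}$: that is, $e,s,t,i$ are graphs of functions, $G_2$ is the pullback of $s$ and $t$ (the set of $(g,f)$ with $s(g)=t(f)$), and $G_0$ (objects), $G_1$ (morphisms), $s$ (source), $t$ (target), $e$ (identities), $i$ (inverses) and $m\colon G_2\to G_1$, $(g,f)\mapsto gf$ (composition) constitute a small category in which every morphism is invertible with inverse given by $i$.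
   Context: $\mathbf{Rel}$ is the category of sets and relations: morphisms $r\colon X\to Y$ are subsets $r\subseteq X\times Y$, with composition $s\circ r=\{(x,z)\mid\exists y:(x,y)\in r,(y,z)\in s\}$. $r^\dagger$ is the converse relation, $\times$ (on objects and morphisms) is the monoidal structure given by Cartesian product of sets, the symbol $1$ denotes both identity relations and the one-point set, and associativity and unit isomorphisms are suppressed. Functions are identified with their graphs. A relative Frobenius algebra is a set $X$ with a relation $m\colon X\times X\to X$ in $\mathbf{Rel}$ such that: (F) $(1\times m)\circ(m^\dagger\times 1)=m^\dagger\circ m=(m\times 1)\circ(1\times m^\dagger)$; (M) $m\circ m^\dagger=1$; (A) $m\circ(1\times m)=m\circ(m\times 1)$; (U) there is a relation $u\colon 1\to X$ with $m\circ(u\times 1)=1=m\circ(1\times u)$ (such $u$ is unique). By (M), $m$ is single-valued; write $f=hg$ for $((h,g),f)\in m$, and $hg\downarrow$ if such $f$ exists. The relation $u$ is identified with a subset $U\subseteq X$. *)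

(* Defs.v *)
From mathcomp Require Import all_boot.
From mathcomp Require Import boolp classical_sets.

Set Implicit Arguments.
Unset Strict Implicit.
Unset Printing Implicit Defensive.

Local Open Scope classical_set_scope.
Local Open Scope relation_scope.

(* A morphism X -> Y of Rel is a [set (X * Y)]. In [relation_scope], [s \; r]
   is the composite "s after r", [r^-1] is the converse relation, and
   [diagonal] is the identity. *)

Definition graph {X Y : Type} (f : X -> Y) : set (X * Y) :=
  [set p | p.2 = f p.1].

Definition rel_prod {X X' Y Y' : Type} (r : set (X * Y)) (s : set (X' * Y')) :
    set ((X * X') * (Y * Y')) :=
  [set p | r (p.1.1, p.2.1) /\ s (p.1.2, p.2.2)].

(* The coherence isomorphisms of the Cartesian product, inserted where strict
   notation suppresses them. *)

Definition assoc_rel {X Y Z : Type} : set (((X * Y) * Z) * (X * (Y * Z))) :=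
  graph (fun p => (p.1.1, (p.1.2, p.2))).

Definition lunit_rel {X : Type} : set ((unit * X) * X) := graph snd.

Definition runit_rel {X : Type} : set ((X * unit) * X) := graph fst.

Definition is_rel_unit {X : Type} (m : set ((X * X) * X)) (u : set (unit * X)) :
    Prop :=
  m \; rel_prod u diagonal = lunit_rel /\
  m \; rel_prod diagonal u = runit_rel.

Record rel_frobenius {X : Type} (m : set ((X * X) * X)) : Prop := RelFrobenius {
  rel_frobeniusFl :
    rel_prod diagonal m \; (assoc_rel \; rel_prod m^-1 diagonal) = m^-1 \; m;
  rel_frobeniusFr :
    m^-1 \; m = rel_prod m diagonal \; (assoc_rel^-1 \; rel_prod diagonal m^-1);
  rel_frobeniusM : m \; m^-1 = diagonal;
  rel_frobeniusA :
    m \; (rel_prod diagonal m \; assoc_rel) = m \; rel_prod m diagonal;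
  rel_frobeniusU : exists u, is_rel_unit m u
}.

(* Composites are written in applicative order: [(g, f) \in G2] means that
   "g after f" is defined. The membership hypotheses in the unit, associativity
   and inverse laws are only there to form the composites; they all follow from
   [cat_pullback] and the source and target laws. *)

Record is_small_category {G0 G1 : Type} (G2 : set (G1 * G1)) (s t : G1 -> G0)
    (e : G0 -> G1) (c : G2 -> G1) : Prop := IsSmallCategory {
  cat_pullback : G2 = [set p | s p.1 = t p.2];
  cat_src_id : forall x, s (e x) = x;
  cat_tgt_id : forall x, t (e x) = x;
  cat_src_comp : forall g f (gf : (g, f) \in G2),
    s (c (exist _ (g, f) gf)) = s f;
  cat_tgt_comp : forall g f (gf : (g, f) \in G2),
    t (c (exist _ (g, f) gf)) = t g;
  cat_idr : forall f (H : (f, e (s f)) \in G2),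
    c (exist _ (f, e (s f)) H) = f;
  cat_idl : forall f (H : (e (t f), f) \in G2),
    c (exist _ (e (t f), f) H) = f;
  cat_assoc : forall h g f (hg : (h, g) \in G2) (gf : (g, f) \in G2)
      (h_gf : (h, c (exist _ (g, f) gf)) \in G2)
      (hg_f : (c (exist _ (h, g) hg), f) \in G2),
    c (exist _ (h, c (exist _ (g, f) gf)) h_gf) =
    c (exist _ (c (exist _ (h, g) hg), f) hg_f)
}.

Record is_groupoid {G0 G1 : Type} (G2 : set (G1 * G1)) (s t : G1 -> G0)
    (e : G0 -> G1) (i : G1 -> G1) (c : G2 -> G1) : Prop := IsGroupoid {
  groupoid_category : is_small_category s t e c;
  groupoid_src_inv : forall f, s (i f) = t f;
  groupoid_tgt_inv : forall f, t (i f) = s f;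
  groupoid_invl : forall f (H : (i f, f) \in G2),
    c (exist _ (i f, f) H) = e (s f);
  groupoid_invr : forall f (H : (f, i f) \in G2),
    c (exist _ (f, i f) H) = e (t f)
}.

Section GroupoidData.
Context {X : Type} (m : set ((X * X) * X)) (u : set (unit * X)).

Definition comp_defined (h g : X) : Prop := exists f, m ((h, g), f).

Definition G0 : set X := [set x | u (tt, x)].

Definition G2 : set (X * X) := [set p | comp_defined p.1 p.2].

Definition e_rel : set (G0 * X) := [set p | p.2 = val p.1].

Definition s_rel : set (X * G0) := [set p | comp_defined p.1 (val p.2)].

Definition t_rel : set (X * G0) := [set p | comp_defined (val p.2) p.1].

Definition i_rel : set (X * X) :=
  [set p | [/\ G2 p, (exists2 x, m ((p.1, p.2), x) & G0 x)
                   & (exists2 y, m ((p.2, p.1), y) & G0 y)]].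

Definition comp_rel : set (G2 * X) := [set p | m (val p.1, p.2)].

End GroupoidData.

Arguments e_rel {X} u.
Arguments s_rel {X} m u.
Arguments t_rel {X} m u.
Arguments i_rel {X} m u.
Arguments comp_rel {X} m.

(* Main.v *)
Require Import Defs.
From mathcomp Require Import all_boot.
From mathcomp Require Import boolp classical_sets.

(** Over elements, (M) makes [m] a partial operation onto [X], (A) is
    associativity of defined composites, and the first Frobenius equation reads:
    for all [a], [b], [c], [d],
      [ab = cd] with both sides defined
      iff [a = ck] and [kb = d] for some [k].
    Both directions carry a part of the theorem.

    From right to left it is the pullback property. If [x] is a unit that acts
    on the right of [g] and on the left of [f], then [g = gx] and [xf = f], so
    [gf] is defined ([comp_defined_mid]); the converse is associativity. That
    each [f] has just one source and one target follows from associativity too: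
    [x (y f) = f] forces [xy] to be defined, and two units with a composite are
    equal, as the composite equals each of them ([unit_comp_eq]).

    From left to right it produces inverses. If [x] is the source and [y] the
    target of [f], then [yf = fx], hence [y = fk] and [kf = x] for some [k]
    ([inverse_exists]). This [k] is the inverse, unique by the usual argument
    [k = k (f k') = (k f) k' = k']. *)

Set Implicit Arguments.
Unset Strict Implicit.
Unset Printing Implicit Defensive.

Local Open Scope classical_set_scope.
Local Open Scope relation_scope.

Lemma graphP (X Y : Type) (f : X -> Y) x y : graph f (x, y) <-> y = f x.
Proof. by []. Qed.

Lemma graph_of_functional (X Y : Type) (r : set (X * Y)) :
  (forall x, exists y, r (x, y)) ->
  (forall x y z, r (x, y) -> r (x, z) -> y = z) ->
  exists f, r = graph f.
Proof.
move=> r_tot r_fun; have [f rf] := choice r_tot.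
exists f; apply/predeqP => -[x y]; rewrite /graph /=; split=> [rxy|->//].
exact: r_fun rxy (rf x).
Qed.

Section Elements.
Context {X : Type} (m : set ((X * X) * X)) (u : set (unit * X)).
Context (Fm : rel_frobenius m) (Um : is_rel_unit m u).
Implicit Types a b c d f g h k x y z : X.

Lemma comp_fun p x y : m (p, x) -> m (p, y) -> x = y.
Proof.
move=> mx my.
by have /predeqP /(_ (x, y)) [+ _] := rel_frobeniusM Fm; apply; exists p.
Qed.

Lemma comp_assocl h g f k n :
  m ((g, f), k) -> m ((h, k), n) -> exists2 l, m ((h, g), l) & m ((l, f), n).
Proof.
move=> gf hk; have /predeqP /(_ (((h, g), f), n)) [+ _] := rel_frobeniusA Fm.
case=> [|[l f'] [/= hg /diagonalP <-] lf]; last by exists l.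
by exists (h, k) => //; exists (h, (g, f)).
Qed.

Lemma comp_assocr h g f l n :
  m ((h, g), l) -> m ((l, f), n) -> exists2 k, m ((g, f), k) & m ((h, k), n).
Proof.
move=> hg lf; have /predeqP /(_ (((h, g), f), n)) [_ +] := rel_frobeniusA Fm.
case=> [|[h' k] [_ /graphP -> [/= /diagonalP <- gf]] hk]; last by exists k.
by exists (l, f).
Qed.

(** Half of the Frobenius law: a commutative square has a diagonal filler. In
    the groupoid the filler is [k = c^-1 a = d b^-1], so this is the only source
    of inverses. *)
Lemma comp_fill a b c d n :
  m ((a, b), n) -> m ((c, d), n) -> exists2 k, m ((c, k), a) & m ((k, b), d).
Proof.
move=> ab cd; have /predeqP /(_ ((a, b), (c, d))) [_ +] := rel_frobeniusFl Fm.
case=> [|_ [[[c' k] b'] [/= ck /diagonalP <-] /graphP ->]]; first by exists n.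
by move=> [/= /diagonalP <- kb]; exists k.
Qed.

(** The other half of the Frobenius law: composability of [a] and [b] is
    decided by the right factor [k] of [a]. With [k] a unit, it makes equality
    of source and target sufficient for a composite to exist. *)
Lemma comp_defined_mid a b c d k :
  m ((c, k), a) -> m ((k, b), d) -> comp_defined m a b.
Proof.
move=> ck kb; have /predeqP /(_ ((a, b), (c, d))) [+ _] := rel_frobeniusFl Fm.
case=> [|n /= ab _]; last by exists n.
by exists (c, (k, b)) => //; exists ((c, k), b).
Qed.

Lemma unit_idl x f g : G0 u x -> m ((x, f), g) -> g = f.
Proof.
move=> ux xf; have /predeqP /(_ ((tt, f), g)) [+ _] := Um.1.
by apply; exists (x, f).
Qed.

Lemma unit_idr x f g : G0 u x -> m ((f, x), g) -> g = f.
Proof.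
move=> ux fx; have /predeqP /(_ ((f, tt), g)) [+ _] := Um.2.
by apply; exists (f, x).
Qed.

Lemma unit_left_exists f : exists2 y, G0 u y & m ((y, f), f).
Proof.
have /predeqP /(_ ((tt, f), f)) [_ /(_ erefl)] := Um.1.
by case=> -[y f'] [/= uy /diagonalP <-] yf; exists y.
Qed.

Lemma unit_right_exists f : exists2 x, G0 u x & m ((f, x), f).
Proof.
have /predeqP /(_ ((f, tt), f)) [_ /(_ erefl)] := Um.2.
by case=> -[f' x] [/= /diagonalP <- ux] fx; exists x.
Qed.

Lemma comp_unitl y f : G0 u y -> comp_defined m y f -> m ((y, f), f).
Proof. by move=> uy [g yf]; rewrite -{2}(unit_idl uy yf). Qed.

Lemma comp_unitr x f : G0 u x -> comp_defined m f x -> m ((f, x), f).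
Proof. by move=> ux [g fx]; rewrite -{2}(unit_idr ux fx). Qed.

Lemma unit_comp_eq x y : G0 u x -> G0 u y -> comp_defined m x y -> x = y.
Proof. by move=> ux uy [z xy]; rewrite -(unit_idl ux xy) (unit_idr uy xy). Qed.

(** The composite [x (y f) = f] exists, so [xy] exists by associativity, and
    composable units are equal. *)
Lemma unit_left_unique f x y : G0 u x -> G0 u y ->
  comp_defined m x f -> comp_defined m y f -> x = y.
Proof.
move=> ux uy /(comp_unitl ux) xf /(comp_unitl uy) yf.
by have [k xy _] := comp_assocl yf xf; apply: unit_comp_eq => //; exists k.
Qed.

Lemma unit_right_unique f x y : G0 u x -> G0 u y ->
  comp_defined m f x -> comp_defined m f y -> x = y.
Proof.
move=> ux uy /(comp_unitr ux) fx /(comp_unitr uy) fy.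
by have [k xy _] := comp_assocr fx fy; apply: unit_comp_eq => //; exists k.
Qed.

Lemma unit_idem x : G0 u x -> m ((x, x), x).
Proof.
move=> ux; have [y uy yx] := unit_left_exists x.
by rewrite -{1}(unit_comp_eq uy ux _) //; exists x.
Qed.

(** The pullback property, with the source of [g] written as a unit [x]: the
    right-hand side says that [x] is the target of [f]. The forward direction
    reassociates [(g x) f]; the backward one uses [x] as the middle factor. *)
Lemma comp_definedP g f x : G0 u x -> comp_defined m g x ->
  comp_defined m g f <-> comp_defined m x f.
Proof.
move=> ux /(comp_unitr ux) gx; split=> [[k gf]|[k xf]].
  by have [l xf _] := comp_assocr gx gf; exists l.
exact: comp_defined_mid gx xf.
Qed.

Lemma comp_defined_compr g f k x :
  m ((g, f), k) -> G0 u x -> comp_defined m f x -> comp_defined m k x.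
Proof.
move=> gf ux /(comp_unitr ux) fx.
by have [l /(comp_fun gf) <- kx] := comp_assocl fx gf; exists k.
Qed.

Lemma comp_defined_compl g f k y :
  m ((g, f), k) -> G0 u y -> comp_defined m y g -> comp_defined m y k.
Proof.
move=> gf uy /(comp_unitl uy) yg.
by have [l /(comp_fun gf) <- yk] := comp_assocr yg gf; exists k.
Qed.

(** The square [y f = f x] formed by [f] and its identities has a filler, and
    its two triangles are the two inverse laws. *)
Lemma inverse_exists f : exists k, i_rel m u (f, k).
Proof.
have [x ux fx] := unit_right_exists f; have [y uy yf] := unit_left_exists f.
have [k fk kf] := comp_fill yf fx.
by exists k; split; [exists y | exists y | exists x].
Qed.

Lemma inverse_unique f k l : i_rel m u (f, k) -> i_rel m u (f, l) -> k = l.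
Proof.
move=> [_ _ [/= x kf ux]] [_ [/= y fl uy] _].
(* the common value is the triple composite [k f l] *)
have [n xl] := comp_defined_mid kf fl.
have [y' fl' ky] := comp_assocr kf xl.
rewrite -(comp_fun fl fl') in ky.
by rewrite -(unit_idr uy ky) (unit_idl ux xl).
Qed.

End Elements.

Theorem theorem7 (X : Type) (m : set ((X * X) * X)) (u : set (unit * X)) :
  rel_frobenius m -> is_rel_unit m u ->
  exists (e : G0 u -> X) (s t : X -> G0 u) (i : X -> X) (c : G2 m -> X),
    [/\ e_rel u = graph e, s_rel m u = graph s, t_rel m u = graph t,
        i_rel m u = graph i & comp_rel m = graph c] /\
    is_groupoid s t e i c.
Proof.
move=> Fm Um.
have val_unit (x : G0 u) : G0 u (val x) := set_valP x.
have [s s_graph] : exists s, s_rel m u = graph s.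
  apply: graph_of_functional => [f|f x y fx fy].
    have [x ux fx] := unit_right_exists Um f.
    by exists (SigSub (mem_set ux)); exists f.
  exact/val_inj/(unit_right_unique Fm Um _ _ fx fy).
have [t t_graph] : exists t, t_rel m u = graph t.
  apply: graph_of_functional => [f|f x y xf yf].
    have [y uy yf] := unit_left_exists Um f.
    by exists (SigSub (mem_set uy)); exists f.
  exact/val_inj/(unit_left_unique Fm Um _ _ xf yf).
have [i i_graph] : exists i, i_rel m u = graph i.
  apply: graph_of_functional => [f|f k l]; first exact: inverse_exists.
  exact: inverse_unique.
have [c c_graph] : exists c, comp_rel m = graph c.
  apply: graph_of_functional => [[[g f] gf]|p x y]; last exact: comp_fun.
  exact: set_mem gf.
have srcP f x : comp_defined m f (val x) <-> x = s f.
  by have /predeqP /(_ (f, x)) := s_graph.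
have tgtP f x : comp_defined m (val x) f <-> x = t f.
  by have /predeqP /(_ (f, x)) := t_graph.
have src_def f : comp_defined m f (val (s f)) by apply/srcP.
have tgt_def f : comp_defined m (val (t f)) f by apply/tgtP.
have cE g f gf : m ((g, f), c (exist _ (g, f) gf)).
  have /predeqP /(_ (exist _ (g, f) gf, c (exist _ (g, f) gf))) [_] := c_graph.
  exact.
have invP f : i_rel m u (f, i f).
  by have /predeqP /(_ (f, i f)) [_] := i_graph; apply.
have src_comp g f k : m ((g, f), k) -> s k = s f.
  by move=> gf; apply/esym/srcP; apply: (comp_defined_compr Fm Um gf) (src_def f).
have tgt_comp g f k : m ((g, f), k) -> t k = t g.
  by move=> gf; apply/esym/tgtP; apply: (comp_defined_compl Fm Um gf) (tgt_def g).
have comp_matchP g f : comp_defined m g f <-> s g = t f.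
  by rewrite (comp_definedP Fm Um f (val_unit (s g)) (src_def g)) tgtP.
have src_unit x : s (val x) = x.
  by apply/esym/srcP; exists (val x); apply: (unit_idem Um).
have tgt_unit x : t (val x) = x.
  by apply/esym/tgtP; exists (val x); apply: (unit_idem Um).
have src_inv f : s (i f) = t f.
  have [_ [/= y f_if uy] _] := invP f.
  rewrite -(src_comp _ _ _ f_if) -(tgt_comp _ _ _ f_if).
  (* the composite [f (i f)] is a unit, so its source is its target *)
  by rewrite -[y]/(val (SigSub (mem_set uy) : G0 u)) src_unit tgt_unit.
have tgt_inv f : t (i f) = s f.
  by have [/= /comp_matchP -> _ _] := invP f.
exists val, s, t, i, c; split; first by split.
split=> //; first split=> //.
- by apply/predeqP => -[g f]; apply: comp_matchP.
- by move=> g f gf; apply: src_comp (cE _ _ gf).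
- by move=> g f gf; apply: tgt_comp (cE _ _ gf).
- by move=> f H; apply: (unit_idr Um (val_unit (s f)) (cE _ _ H)).
- by move=> f H; apply: (unit_idl Um (val_unit (t f)) (cE _ _ H)).
- move=> h g f hg gf h_gf hg_f.
  have [l hl lf] := comp_assocl Fm (cE _ _ gf) (cE _ _ h_gf).
  by rewrite (comp_fun Fm hl (cE _ _ hg)) in lf; apply: comp_fun lf (cE _ _ _).
- move=> f H; have [_ _ [/= x if_f ux]] := invP f.
  rewrite (comp_fun Fm (cE _ _ H) if_f) -(src_comp _ _ _ if_f).
  by rewrite -[x]/(val (SigSub (mem_set ux) : G0 u)) src_unit.
- move=> f H; have [_ [/= y f_if uy] _] := invP f.
  rewrite (comp_fun Fm (cE _ _ H) f_if) -(tgt_comp _ _ _ f_if).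
  by rewrite -[y]/(val (SigSub (mem_set uy) : G0 u)) tgt_unit.
Qed.
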